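(* Let $\mathcal{A}\in\mathfrak{R}^{n_1\times n_2}$. Then the $\mathcal{L}$-SVD algorithm (defined in the context) outputs an $\mathcal{L}$-SVD of $\mathcal{A}$: $$\mathcal{A}=\mathcal{U}\bullet\mathcal{S}\bullet\mathcal{V}^{H},$$ where $\mathcal{U}\in\mathfrak{R}^{n_1\times n_1}$ and $\mathcal{V}\in\mathfrak{R}^{n_2\times n_2}$ are orthogonal and $\mathcal{S}\in\mathfrak{R}^{n_1\times n_2}$ is $\mathcal{L}$-diagonal.
   Context: Fix positive integers $n_3,n_4$. Let $\mathfrak{R}=\mathbb{R}^{1\times1\times n_3\times n_4}$; its elements are called tensor-scalars, addition is entrywise, and $\mathbf{0}$ is the zero tensor-scalar. Let $\mathcal{L}:\mathfrak{R}\to\mathfrak{R}$ be a fixed invertible two-dimensional discrete transform (an invertible $\mathbb{R}$-linear map), and let $*$ be the entrywise product. Tensor-scalar multiplication is $\alpha\bullet\beta=\mathcal{L}^{-1}(\mathcal{L}(\alpha)*\mathcal{L}(\beta))$. Put $e=\mathcal{L}^{-1}(\mathbf{1})$, with $\mathbf{1}$ the all-ones tensor-scalar. A fourth-order tensor $\mathcal{A}\in\mathbb{R}^{n_1\times n_2\times n_3\times n_4}$ is viewed as an $n_1\times n_2$ matrix with entries $\mathcal{A}(i,j)\in\mathfrak{R}$, so $\mathbb{R}^{n_1\times n_2\times n_3\times n_4}=\mathfrak{R}^{n_1\times n_2}$. The $\mathcal{L}$-product of $\mathcal{A}\in\mathfrak{R}^{n_1\times n'}$ and $\mathcal{B}\in\mathfrak{R}^{n'\times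 n_2}$ is $(\mathcal{A}\bullet\mathcal{B})(i,j)=\sum_{k=1}^{n'}\mathcal{A}(i,k)\bullet\mathcal{B}(k,j)$. Write $\widetilde{\mathcal{A}}=\mathcal{L}(\mathcal{A})$ for the tensor obtained by applying $\mathcal{L}$ to each tensor-scalar entry. With $P=n_3n_4$, enumerate the pairs $(k,\ell)\in[n_3]\times[n_4]$ by $p\in[P]$; $\widetilde{\mathbf{A}}^p$ is the $n_1\times n_2$ matrix with $(i,j)$ entry $\widetilde{\mathcal{A}}(i,j,k,\ell)$. The Hermitian transpose $\mathcal{A}^H\in\mathfrak{R}^{n_2\times n_1}$ is the tensor whose transform-domain matrices are $\widetilde{\mathbf{A}^H}^p=(\widetilde{\mathbf{A}}^p)^H$ for all $p$ (conjugate transposes). The identity tensor $\mathcal{I}\in\mathfrak{R}^{n\times n}$ has $e$ on the diagonal and $\mathbf{0}$ elsewhere. $\mathcal{Q}\in\mathfrak{R}^{n\times n}$ is orthogonal if $\mathcal{Q}^H\bullet\mathcal{Q}=\mathcal{Q}\bullet\mathcal{Q}^H=\mathcal{I}$. A tensor is $\mathcal{L}$-diagonal if $\mathcal{A}(i,j)=\mathbf{0}$ for $i\neq j$. The $\mathcal{L}$-SVD algorithm, on input $\mathcal{A}$: (1) compute $\widetilde{\mathcal{A}}=\mathcal{L}(\mathcal{A})$ and its matrices $\widetilde{\mathbf{A}}^1,\dots,\widetilde{\mathbf{A}}^P$; (2) for each $p\in[P]$ compute a (full) matrix SVD $\widetilde{\mathbf{A}}^p=\widetilde{\mathbf{U}}^p\,\widetilde{\mathbf{S}}^p\,\widetilde{\mathbf{V}}^p$,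 where $\widetilde{\mathbf{U}}^p$ ($n_1\times n_1$) and the right factor $\widetilde{\mathbf{V}}^p$ ($n_2\times n_2$) are orthogonal/unitary and $\widetilde{\mathbf{S}}^p$ ($n_1\times n_2$) is diagonal; (3) assemble the tensors $\widetilde{\mathcal{U}},\widetilde{\mathcal{S}},\widetilde{\mathcal{V}}$ whose $p$th matrices are these factors and output $\mathcal{U}=\mathcal{L}^{-1}(\widetilde{\mathcal{U}})$, $\mathcal{S}=\mathcal{L}^{-1}(\widetilde{\mathcal{S}})$, $\mathcal{V}^H=\mathcal{L}^{-1}(\widetilde{\mathcal{V}})$. *)

(* Defs.v *)
From HB Require Import structures.
From mathcomp Require Import all_boot all_order all_algebra.
From mathcomp Require Import reals.

Set Implicit Arguments.
Unset Strict Implicit.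
Unset Printing Implicit Defensive.

Import GRing.Theory.
Local Open Scope ring_scope.

(* An element of R^(1 x 1 x n3 x n4) is encoded as an n3 x n4 matrix, and a
   fourth-order tensor as an n1 x n2 matrix of such elements. *)
Notation tscalar R n3 n4 := 'M[R]_(n3, n4).
Notation tensor R n1 n2 n3 n4 := 'M[tscalar R n3 n4]_(n1, n2).

Record transform (R : realType) (n3 n4 : nat) := Transform {
  fwd :> {linear tscalar R n3 n4 -> tscalar R n3 n4};
  bwd : tscalar R n3 n4 -> tscalar R n3 n4;
  fwdK : cancel fwd bwd;
  bwdK : cancel bwd fwd }.

Section TensorAlgebra.
Variables (R : realType) (n3 n4 : nat) (L : transform R n3 n4).

Definition tsmul (a b : tscalar R n3 n4) : tscalar R n3 n4 :=
  bwd L (map2_mx *%R (L a) (L b)).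

Definition tsone : tscalar R n3 n4 := bwd L (const_mx 1).

Definition tmul n1 n n2 (A : tensor R n1 n n3 n4) (B : tensor R n n2 n3 n4) :
    tensor R n1 n2 n3 n4 :=
  \matrix_(i, j) \sum_k tsmul (A i k) (B k j).

Definition tid n : tensor R n n n3 n4 :=
  \matrix_(i, j) if i == j then tsone else 0.

Definition slice n1 n2 (A : tensor R n1 n2 n3 n4) (k : 'I_n3) (l : 'I_n4) :
    'M[R]_(n1, n2) :=
  \matrix_(i, j) A i j k l.

Definition assemble n1 n2 (F : 'I_n3 -> 'I_n4 -> 'M[R]_(n1, n2)) :
    tensor R n1 n2 n3 n4 :=
  \matrix_(i, j) \matrix_(k, l) F k l i j.

Definition ttrans n1 n2 (A : tensor R n1 n2 n3 n4) : tensor R n1 n2 n3 n4 :=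
  map_mx L A.

Definition tinvtrans n1 n2 (A : tensor R n1 n2 n3 n4) : tensor R n1 n2 n3 n4 :=
  map_mx (bwd L) A.

(* The transform-domain matrices are real, so that their conjugate transposes
   are their transposes. *)
Definition therm n1 n2 (A : tensor R n1 n2 n3 n4) : tensor R n2 n1 n3 n4 :=
  tinvtrans (assemble (fun k l => (slice (ttrans A) k l)^T)).

Definition torthogonal n (Q : tensor R n n n3 n4) : Prop :=
  tmul (therm Q) Q = tid n /\ tmul Q (therm Q) = tid n.

Definition tdiagonal n1 n2 (A : tensor R n1 n2 n3 n4) : Prop :=
  forall (i : 'I_n1) (j : 'I_n2), i <> j :> nat -> A i j = 0.

Definition orthogonal_mx n (Q : 'M[R]_n) : Prop :=
  Q^T *m Q = 1%:M /\ Q *m Q^T = 1%:M.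

(* V is the right factor itself, not its transpose.  The singular values are
   nonnegative but need not be sorted. *)
Definition matrix_svd n1 n2 (M : 'M[R]_(n1, n2))
    (U : 'M[R]_n1) (S : 'M[R]_(n1, n2)) (V : 'M[R]_n2) : Prop :=
  [/\ M = U *m S *m V, orthogonal_mx U, orthogonal_mx V, is_diag_mx S
    & forall i j, 0 <= S i j].

(* A full matrix SVD is not unique, so the algorithm is the relation between
   its input A and its possible outputs.  It returns the Hermitian transpose
   of V. *)
Definition lsvd_algorithm n1 n2 (A : tensor R n1 n2 n3 n4)
    (U : tensor R n1 n1 n3 n4) (S : tensor R n1 n2 n3 n4)
    (V : tensor R n2 n2 n3 n4) : Prop :=
  exists (Ut : 'I_n3 -> 'I_n4 -> 'M[R]_n1)
         (St : 'I_n3 -> 'I_n4 -> 'M[R]_(n1, n2))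
         (Vt : 'I_n3 -> 'I_n4 -> 'M[R]_n2),
    [/\ forall k l, matrix_svd (slice (ttrans A) k l)
                      (Ut k l) (St k l) (Vt k l),
        U = tinvtrans (assemble Ut),
        S = tinvtrans (assemble St)
      & therm V = tinvtrans (assemble Vt)].

End TensorAlgebra.

(* Main.v *)
Require Import Defs.
From mathcomp Require Import all_boot all_order all_algebra.
From mathcomp Require Import reals.
From mathcomp Require Import boolp classical_sets topology normedtype derive.
From mathcomp Require Import ring lra.
Import Order.TTheory GRing.Theory Num.Theory.
Import numFieldNormedType.Exports.
Local Open Scope ring_scope.

(** In the transform domain a tensor is just a family of [n3 * n4] real
    matrices, its slices, and every tensor operation acts slice by slice: the
    product becomes the matrix product ([slice_ttrans_tmul]), the Hermitian
    transpose becomes the transpose ([slice_ttrans_therm]), and the identity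
    tensor becomes the identity matrix ([slice_ttrans_tid]).  As the transform
    is injective, a tensor identity holds as soon as it holds on all slices
    ([slice_ttrans_inj]).  The factorization and the orthogonality of the
    output of the algorithm are therefore the same facts about the matrix SVDs
    of the slices.  For diagonality, an off-diagonal tube of [S] vanishes in
    the transform domain, hence also in the original one.

    That the algorithm has an output at all is the existence of a real matrix
    SVD ([exists_matrix_svd]), which is proved by deflation.  Let [v] be a unit
    row vector maximizing [|v M|]; it exists since the unit sphere is compact.
    Put [s = |v M|], and suppose [s > 0].  Reflections that send the first
    basis vector to [v] and to [v M / s] turn [M] into a matrix [N] with first
    row [(s, 0)].  Let [c] be the rest of its first column.  The vector
    [w = (s, c^T)] satisfies [|w N| >= s^2 + |c|^2 = |w|^2], while
    [|w N| <= s |w|] by maximality; hence [c = 0] and [N] is block diagonal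
    ([peel_singular_value]).  Induction on the remaining block concludes. *)

(** * Squared Euclidean norm of row vectors *)

Definition sqnorm {R : realType} {n} (x : 'rV[R]_n) : R := (x *m x^T) 0 0.

Lemma sqnormE (R : realType) n (x : 'rV[R]_n) :
  sqnorm x = \sum_j x 0 j ^+ 2.
Proof. by rewrite /sqnorm mxE; apply: eq_bigr => j _; rewrite mxE expr2. Qed.

Lemma mul_trmx_sqnorm (R : realType) n (x : 'rV[R]_n) :
  x *m x^T = (sqnorm x)%:M.
Proof. exact: mx11_scalar. Qed.

Lemma sqnorm_ge0 (R : realType) n (x : 'rV[R]_n) : 0 <= sqnorm x.
Proof. by rewrite sqnormE sumr_ge0 // => j _; rewrite sqr_ge0. Qed.

Lemma sqnorm_eq0 {R : realType} {n} (x : 'rV[R]_n) : sqnorm x = 0 -> x = 0.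
Proof.
rewrite sqnormE => /eqP; rewrite psumr_eq0 => [|j _]; last exact: sqr_ge0.
move=> /allP x0; apply/rowP => j; rewrite mxE; apply/eqP.
by have := x0 j (mem_index_enum j); rewrite /= sqrf_eq0.
Qed.

Lemma sqnormZ (R : realType) n (a : R) (x : 'rV[R]_n) :
  sqnorm (a *: x) = a ^+ 2 * sqnorm x.
Proof. by rewrite /sqnorm linearZ /= -scalemxAl -scalemxAr scalerA mxE. Qed.

Lemma sqnorm0 (R : realType) n : sqnorm (0 : 'rV[R]_n) = 0.
Proof. by rewrite /sqnorm mul0mx mxE. Qed.

Lemma sqnorm_delta (R : realType) n (i : 'I_n) :
  sqnorm (delta_mx 0 i : 'rV[R]_n) = 1.
Proof. by rewrite /sqnorm trmx_delta mul_delta_mx mxE !eqxx. Qed.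

Lemma sqnorm_mul_orthogonal (R : realType) n (Q : 'M[R]_n) (x : 'rV[R]_n) :
  Q *m Q^T = 1%:M -> sqnorm (x *m Q) = sqnorm x.
Proof. by move=> QQ; rewrite /sqnorm trmx_mul mulmxA -(mulmxA x) QQ mulmx1. Qed.

Lemma sqnorm_row_mx (R : realType) m n (x : 'rV[R]_m) (y : 'rV[R]_n) :
  sqnorm (row_mx x y) = sqnorm x + sqnorm y.
Proof. by rewrite /sqnorm tr_row_mx mul_row_col mxE. Qed.

(** * Maximizing the norm of an image over the unit sphere *)

Lemma continuous_sqnorm_mul (R : realType) m n (M : 'M[R]_(m, n)) :
  continuous (fun x : 'rV[R]_m => sqnorm (x *m M)).
Proof.
rewrite (_ : (fun _ => _) = fun x : 'rV[R]_m =>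
  \sum_j (\sum_i x 0 i * M i j) * (\sum_i x 0 i * M i j)); last first.
  by apply/funext => x;
    rewrite sqnormE; apply: eq_bigr => j _; rewrite mxE -expr2.
apply: continuous_big => [|j _]; first exact: add_continuous.
have cF : continuous (fun x : 'rV[R]_m => \sum_i x 0 i * M i j).
  apply: continuous_big => [|i _]; first exact: add_continuous.
  move=> x; apply: continuousM; first exact: coord_continuous.
  exact: cst_continuous.
by move=> x; apply: continuousM; exact: cF.
Qed.

Lemma continuous_sqnorm (R : realType) n : continuous (@sqnorm R n).
Proof.
rewrite (_ : @sqnorm R n = fun x => sqnorm (x *m 1%:M)).
  exact: continuous_sqnorm_mul.
by apply/funext => x; rewrite mulmx1.
Qed.

Lemma compact_unit_sphere (R : realType) n :
  compact [set x : 'rV[R]_n | sqnorm x = 1]%classic.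
Proof.
apply: bounded_closed_compact.
  exists 1; split=> // r r1 x /= x1; apply: le_trans (ltW r1).
  (* The norm of the normed module is the max norm of the entries. *)
  rewrite [leLHS]/Num.norm /= mx_normrE; apply: bigmax_le => // -[i j] _ /=.
  rewrite ord1 -(@ler_pXn2r _ 2) ?nnegrE ?normr_ge0 ?ler01 // expr1n.
  rewrite real_normK ?num_real // -x1 sqnormE (bigD1 j) //= lerDl.
  by apply: sumr_ge0 => k _; exact: sqr_ge0.
apply: (@preimage_closed _ _ (@sqnorm R n) [set 1]%classic) => [x _|].
  exact: continuous_sqnorm.
exact: closed_eq.
Qed.

(** The supremum of [sqnorm (w *m M)] over unit vectors is attained by
    compactness; scaling makes the bound homogeneous, so that it can be applied
    to test vectors without normalizing them. *)
Lemma exists_unit_maximizer (R : realType) m n (M : 'M[R]_(1 + m, n)) :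
  exists2 v, sqnorm v = 1 &
    forall w, sqnorm (w *m M) <= sqnorm (v *m M) * sqnorm w.
Proof.
have [||v] := @EVT_max_rV R _ (fun w => sqnorm (w *m M)) _ _
  (@compact_unit_sphere R (1 + m)).
- by exists (delta_mx 0 0); exact: sqnorm_delta.
- exact/continuous_subspaceT/continuous_sqnorm_mul.
rewrite inE /= => v1 vmax; exists v => // w.
have [w0|w0] := eqVneq (sqnorm w) 0.
  by rewrite (sqnorm_eq0 _ w0) mul0mx !sqnorm0 mulr0.
have wgt0 : 0 < sqnorm w by rewrite lt_def w0 sqnorm_ge0.
have := vmax ((Num.sqrt (sqnorm w))^-1 *: w).
rewrite inE /= -scalemxAl !sqnormZ exprVn sqr_sqrtr ?sqnorm_ge0 // mulVf //.
by move=> /(_ erefl); rewrite mulrC ler_pdivrMr.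
Qed.

(** * Reflections *)

(** The Householder reflection [1 - 2 w^T w / |w|^2] with [w = u - e] exchanges
    the unit vectors [e] and [u], because [e w^T = - |w|^2 / 2].  As the inverse
    of [0] is [0], the formula gives the identity when [u = e]. *)
Lemma exists_reflection (R : realType) n (u : 'rV[R]_(1 + n)) :
  sqnorm u = 1 ->
  exists H : 'M[R]_(1 + n),
    [/\ H^T = H, H *m H = 1%:M & delta_mx 0 0 *m H = u].
Proof.
move=> u1; pose e : 'rV[R]_(1 + n) := delta_mx 0 0.
pose w := u - e; pose c := 2 / sqnorm w.
have ccw : c ^+ 2 * sqnorm w = 2 * c.
  rewrite /c; have [->|w0] := eqVneq (sqnorm w) 0; last by field.
  by rewrite invr0; ring.
have ew : e *m w^T = (u 0 0 - 1)%:M.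
  rewrite [LHS]mx11_scalar /w linearB /= mulmxBr /e trmx_delta mul_delta_mx.
  by rewrite -rowE !mxE !eqxx.
have dw : sqnorm w = - 2 * (u 0 0 - 1).
  rewrite /sqnorm {1}/w mulmxBl ew /w linearB /= mulmxBr mul_trmx_sqnorm u1.
  rewrite trmx_delta -colE !mxE eqxx /=; ring.
pose H := 1%:M - c *: (w^T *m w).
have Ht : H^T = H.
  by rewrite /H linearB /= linearZ /= trmx1 trmx_mul trmxK.
exists H; split=> //.
- rewrite /H mulmxBr mulmx1 mulmxBl mul1mx -scalemxAl -scalemxAr scalerA.
  rewrite mulmxA -(mulmxA _ w) mul_trmx_sqnorm mul_mx_scalar -scalemxAl scalerA.
  by rewrite -expr2 ccw mulr2n mulrDl mul1r scalerDl opprB addrK subrK.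
- rewrite -/e /H mulmxBr mulmx1 -scalemxAr mulmxA ew mul_scalar_mx scalerA.
  have [d0|d0] := eqVneq (sqnorm w) 0.
    have /eqP := sqnorm_eq0 _ d0; rewrite /w subr_eq0 => /eqP <-.
    by rewrite subrr scaler0 subr0.
  suff -> : c * (u 0 0 - 1) = -1 by rewrite scaleN1r opprK addrC subrK.
  by apply: (mulfI d0); rewrite {2}dw /c; field.
Qed.

(** * Existence of the matrix SVD *)

Lemma orthogonal_mx1 (R : realType) n : orthogonal_mx (1%:M : 'M[R]_n).
Proof. by rewrite /orthogonal_mx trmx1 mulmx1. Qed.

Lemma orthogonal_mxM (R : realType) n (P Q : 'M[R]_n) :
  orthogonal_mx P -> orthogonal_mx Q -> orthogonal_mx (P *m Q).
Proof.
move=> [PtP PPt] [QtQ QQt]; rewrite /orthogonal_mx trmx_mul; split.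
  by rewrite mulmxA -(mulmxA _ _ P) PtP mulmx1.
by rewrite mulmxA -(mulmxA P) QQt mulmx1.
Qed.

Lemma orthogonal_mx_tr (R : realType) n (Q : 'M[R]_n) :
  orthogonal_mx Q -> orthogonal_mx Q^T.
Proof. by case=> QtQ QQt; rewrite /orthogonal_mx trmxK. Qed.

Lemma orthogonal_mx_block (R : realType) n (Q : 'M[R]_n) :
  orthogonal_mx Q -> orthogonal_mx (block_mx (1%:M : 'M_1) 0 0 Q).
Proof.
case=> QtQ QQt; rewrite /orthogonal_mx tr_block_mx !mulmx_block trmx1 !trmx0.
rewrite !mulmx0 !mul0mx !addr0 !add0r mulmx1 QtQ QQt.
by rewrite -scalar_mx_block.
Qed.

(** The deflation step.  The scalar [s] is the operator norm of [M], and its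
    maximality, rather than the spectral theorem for [M *m M^T], forces the first
    column of the reduced matrix to vanish below [s]. *)
Lemma peel_singular_value (R : realType) m n (M : 'M[R]_(1 + m, 1 + n)) :
  M != 0 ->
  exists (P : 'M[R]_(1 + m)) (Q : 'M[R]_(1 + n)) (s : R) (N : 'M[R]_(m, n)),
    [/\ orthogonal_mx P, orthogonal_mx Q, 0 <= s
      & M = P *m block_mx s%:M 0 0 N *m Q].
Proof.
move=> M0; have [v v1 vmax] := exists_unit_maximizer R m _ M.
set k := sqnorm (v *m M) in vmax.
have k_gt0 : 0 < k.
  rewrite lt_def sqnorm_ge0 andbT; apply: contraNneq M0 => k0.
  apply/eqP/row_matrixP => i; rewrite row0; apply: sqnorm_eq0; apply/eqP.
  by rewrite eq_le sqnorm_ge0 andbT rowE (le_trans (vmax _)) // k0 mul0r.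
pose s := Num.sqrt k; have s_gt0 : 0 < s by rewrite sqrtr_gt0.
have ss : s ^+ 2 = k by rewrite sqr_sqrtr ?ltW.
have u1 : sqnorm (s^-1 *: (v *m M)) = 1.
  by rewrite sqnormZ exprVn ss mulVf ?gt_eqF.
have [P [Pt PP eP]] := exists_reflection R m v v1.
have [Q [Qt QQ eQ]] := exists_reflection R n _ u1.
have oP : orthogonal_mx P by rewrite /orthogonal_mx Pt PP.
have oQ : orthogonal_mx Q by rewrite /orthogonal_mx Qt QQ.
pose N := P *m M *m Q; have NM : M = P *m N *m Q.
  by rewrite /N !mulmxA PP mul1mx -mulmxA QQ mulmx1.
have Nmax w : sqnorm (w *m N) <= k * sqnorm w.
  rewrite /N !mulmxA sqnorm_mul_orthogonal ?oQ.2 //.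
  by rewrite -[sqnorm w](@sqnorm_mul_orthogonal _ _ P) ?oP.2.
have N1 : row_mx (ulsubmx N) (ursubmx N) = row_mx s%:M 0.
  rewrite hsubmxK; apply: (@trans_eq _ _ (delta_mx 0 0 *m N)).
    by rewrite -rowE; apply/rowP => j; rewrite !mxE lshift0.
  rewrite /N !mulmxA eP -[v *m M](scalerKV (lt0r_neq0 s_gt0)).
  rewrite -eQ -scalemxAl -mulmxA QQ mulmx1.
  have -> : delta_mx 0 0 = row_mx 1%:M 0 :> 'rV[R]_(1 + n).
    apply/rowP => j; case: (split_ordP j) => j' ->.
      by rewrite row_mxEl !mxE !ord1 eqxx -val_eqE.
    by rewrite row_mxEr !mxE -val_eqE.
  by rewrite scale_row_mx scaler0 scalemx1.
have [Nul Nur] := eq_row_mx N1.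
pose c := dlsubmx N.
have c0 : c = 0.
  (* The test vector is the transposed first column of N, so that the first
     entry of its image is its own squared norm. *)
  have := Nmax (row_mx s%:M c^T).
  rewrite -{1}[N]submxK Nul Nur mul_row_block -/c !sqnorm_row_mx.
  rewrite -scalar_mxM -[c in X in _ *m X]trmxK mul_trmx_sqnorm -raddfD /=.
  have sq1 a : sqnorm (a%:M : 'M[R]_1) = a ^+ 2.
    by rewrite sqnormE big_ord1 mxE eqxx.
  rewrite !sq1 -expr2 ss => le1.
  have q_ge0 := sqnorm_ge0 _ _ c^T.
  have r_ge0 := sqnorm_ge0 _ _ (s%:M *m 0 + c^T *m drsubmx N).
  apply/trmx_inj; rewrite trmx0; apply/sqnorm_eq0/eqP; rewrite eq_le q_ge0 andbT.
  by nra.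
exists P, Q, s, (drsubmx N); split; [by []|by []|exact: ltW|].
by rewrite {1}NM -{1}[N]submxK Nul Nur -/c c0.
Qed.

(** Deflation stops at a zero matrix, which covers both the empty shapes and a
    zero remainder, so that the induction never meets a zero singular value and
    works for any rectangular shape. *)
Lemma exists_matrix_svd (R : realType) m n (M : 'M[R]_(m, n)) :
  exists U S V, matrix_svd M U S V.
Proof.
have svd0 m' n' : exists U S V, matrix_svd (0 : 'M[R]_(m', n')) U S V.
  exists 1%:M, 0, 1%:M; split; do ?exact: orthogonal_mx1.
  - by rewrite mulmx0 mul0mx.
  - exact: mx0_is_diag.
  - by move=> i j; rewrite mxE.
elim: m n M => [|m IHm] [|n] M; try by rewrite ?flatmx0 ?thinmx0.
have [->//|/(@peel_singular_value R m n)] := eqVneq M 0.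
move=> [P [Q [s [N [oP oQ s_ge0 ->]]]]].
have [U [S [V [-> oU oV dS S_ge0]]]] := IHm n N.
have blockE : block_mx s%:M 0 0 (U *m S *m V) =
    block_mx (1%:M : 'M_1) 0 0 U *m block_mx s%:M 0 0 S
    *m block_mx (1%:M : 'M_1) 0 0 V.
  by rewrite !mulmx_block !(mulmx0, mul0mx, mulmx1, mul1mx, addr0, add0r).
exists (P *m block_mx 1%:M 0 0 U).
exists (block_mx s%:M 0 0 S : 'M[R]_(1 + m, 1 + n)).
exists (block_mx 1%:M 0 0 V *m Q); split.
- by rewrite blockE !mulmxA.
- exact/orthogonal_mxM/orthogonal_mx_block.
- exact/orthogonal_mxM/oQ/orthogonal_mx_block.
- by rewrite (@is_diag_block_mx R 1 m 1 n) // !eqxx dS mx11_is_diag.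
- move=> i j; rewrite !mxE.
  case: splitP => i' _; rewrite !mxE; case: splitP => j' _;
    by rewrite ?mxE // !ord1 eqxx.
Qed.

(** * Tensors in the transform domain *)

Section TransformDomain.
Variables (R : realType) (n3 n4 : nat) (L : transform R n3 n4).

Lemma slice_ttrans_inj {n1 n2} (A B : tensor R n1 n2 n3 n4) :
  (forall k l, slice (ttrans L A) k l = slice (ttrans L B) k l) -> A = B.
Proof.
move=> AB; apply/matrixP => i j; apply: (can_inj (fwdK L)).
apply/matrixP => k l; have /matrixP/(_ i j) := AB k l.
by rewrite !mxE.
Qed.

Lemma slice_ttrans_assemble n1 n2 (F : 'I_n3 -> 'I_n4 -> 'M[R]_(n1, n2)) k l :
  slice (ttrans L (tinvtrans L (assemble F))) k l = F k l.
Proof. by apply/matrixP => i j; rewrite !mxE bwdK !mxE. Qed.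

Lemma slice_ttrans_tmul n1 n n2 (A : tensor R n1 n n3 n4)
    (B : tensor R n n2 n3 n4) k l :
  slice (ttrans L (tmul L A B)) k l =
  slice (ttrans L A) k l *m slice (ttrans L B) k l.
Proof.
apply/matrixP => i j; rewrite !mxE linear_sum /= summxE.
by apply: eq_bigr => p _; rewrite /tsmul bwdK !mxE.
Qed.

Lemma slice_ttrans_therm n1 n2 (A : tensor R n1 n2 n3 n4) k l :
  slice (ttrans L (therm L A)) k l = (slice (ttrans L A) k l)^T.
Proof. exact: slice_ttrans_assemble. Qed.

Lemma slice_ttrans_tid n k l : slice (ttrans L (tid L n)) k l = 1%:M.
Proof.
apply/matrixP => i j; rewrite !mxE; case: eqP => _.
  by rewrite /tsone bwdK !mxE.
by rewrite linear0 mxE.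
Qed.

(** The algorithm returns the Hermitian transpose of [V]; involutivity is what
    lets [V] itself be recovered from it. *)
Lemma thermK {n1 n2} (A : tensor R n1 n2 n3 n4) : therm L (therm L A) = A.
Proof.
by apply: slice_ttrans_inj => k l; rewrite !slice_ttrans_therm trmxK.
Qed.

Lemma torthogonal_slices n (Q : tensor R n n n3 n4) :
  (forall k l, orthogonal_mx (slice (ttrans L Q) k l)) -> torthogonal L Q.
Proof.
move=> oQ; split; apply: slice_ttrans_inj => k l;
  rewrite slice_ttrans_tmul slice_ttrans_therm slice_ttrans_tid;
  by have [] := oQ k l.
Qed.

Lemma bwd0 : bwd L 0 = 0.
Proof. by apply: (can_inj (fwdK L)); rewrite bwdK linear0. Qed.

Lemma tdiagonal_assemble n1 n2 (F : 'I_n3 -> 'I_n4 -> 'M[R]_(n1, n2)) :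
  (forall k l, is_diag_mx (F k l)) ->
  tdiagonal (tinvtrans L (assemble F)).
Proof.
move=> dF i j ij; rewrite !mxE -[RHS]bwd0; congr (bwd L _).
apply/matrixP => k l; rewrite !mxE.
by have /is_diag_mxP := dF k l; apply; apply/eqP.
Qed.

End TransformDomain.

Theorem theorem3 (R : realType) (n3 n4 : nat)
    (n3_gt0 : (0 < n3)%N) (n4_gt0 : (0 < n4)%N)
    (L : transform R n3 n4) (n1 n2 : nat) (A : tensor R n1 n2 n3 n4) :
  (exists (U : tensor R n1 n1 n3 n4) (S : tensor R n1 n2 n3 n4)
          (V : tensor R n2 n2 n3 n4), lsvd_algorithm L A U S V) /\
  (forall (U : tensor R n1 n1 n3 n4) (S : tensor R n1 n2 n3 n4)
          (V : tensor R n2 n2 n3 n4), lsvd_algorithm L A U S V ->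
     [/\ A = tmul L (tmul L U S) (therm L V),
         torthogonal L U, torthogonal L V & tdiagonal S]).
Proof.
split=> [|U S V [Ut [St [Vt [svd -> -> Vh]]]]].
  have svdA (p : 'I_n3 * 'I_n4) :
      exists F : 'M[R]_n1 * 'M[R]_(n1, n2) * 'M[R]_n2,
        matrix_svd (slice (ttrans L A) p.1 p.2) F.1.1 F.1.2 F.2.
    have [U [S [V svd]]] :=
      exists_matrix_svd R n1 n2 (slice (ttrans L A) p.1 p.2).
    by exists (U, S, V).
  have [F svdF] := fin_all_exists svdA.
  exists (tinvtrans L (assemble (fun k l => (F (k, l)).1.1))).
  exists (tinvtrans L (assemble (fun k l => (F (k, l)).1.2))).
  exists (therm L (tinvtrans L (assemble (fun k l => (F (k, l)).2)))).
  exists (fun k l => (F (k, l)).1.1), (fun k l => (F (k, l)).1.2).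
  exists (fun k l => (F (k, l)).2); split=> [k l|||] //.
    exact: (svdF (k, l)).
  exact: thermK.
split.
- apply: (slice_ttrans_inj _ _ _ L) => k l; rewrite !slice_ttrans_tmul Vh.
  by rewrite !slice_ttrans_assemble; have [] := svd k l.
- apply: torthogonal_slices => k l; rewrite slice_ttrans_assemble.
  by have [] := svd k l.
- apply: torthogonal_slices => k l; rewrite -(thermK _ _ _ L V) Vh.
  rewrite slice_ttrans_therm slice_ttrans_assemble.
  by apply: orthogonal_mx_tr; have [] := svd k l.
- by apply: tdiagonal_assemble => k l; have [] := svd k l.
Qed.
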